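(* Let $N$ be a matroid such that $\chi(N \setminus e) < \chi(N)$ for some $e \in N$. Then $\mathrm{ex}(\{N\},n) = 2^n(1-2^{1-\chi(N)})$ for all sufficiently large $n$, and this value is attained only by Bose-Burton geometries, i.e. every $n$-dimensional $N$-free matroid $M$ with $|M| = 2^n(1-2^{1-\chi(N)})$ is isomorphic to $\mathrm{BB}(n-1,2,\chi(N)-1)$.
   Context: A matroid of dimension $m$ is a set $M \subseteq \mathbb{F}_2^m \setminus \{0\}$; write $\dim(M) = m$. A linear map $\varphi: \mathbb{F}_2^n \to \mathbb{F}_2^m$ is a homomorphism from $N \subseteq \mathbb{F}_2^n$ to $M \subseteq \mathbb{F}_2^m$ if $\varphi(N) \subseteq M$; it is an isomorphism if it is bijective and $\varphi(N) = M$. A subset of $M$ that is the image of $N$ under an injective linear map $\mathbb{F}_2^n \to \mathbb{F}_2^m$ is an $N$-restriction of $M$. $M$ is $N$-free if it has no $N$-restriction. $\mathrm{ex}(\{N\},n)$ is the maximum size of an $n$-dimensional $N$-free matroid. The critical number $\chi(M)$ of $M \subseteq \mathbb{F}_2^m$ is the smallest codimension of a subspace of $\mathbb{F}_2^m$ disjoint from $M$. The Bose-Burton geometry $\mathrm{BB}(n-1,2,t)$ is the $n$-dimensional matroid consisting of the complement in $\mathbb{F}_2^n$ of an $(n-t)$-dimensional subspace (it has $2^n - 2^{n-t}$ elements). For $e\in N$, $N\setminus e$ denotes $N - \{e\}$ as a matroid of the same dimension. *)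

(* Defs.v *)
From mathcomp Require Export all_boot all_order all_algebra.

Set Implicit Arguments.
Unset Strict Implicit.
Unset Printing Implicit Defensive.

Import GRing.Theory Num.Theory.
Local Open Scope ring_scope.

(* F_2^m is the type of row vectors 'rV['F_2]_m.  Subspaces of F_2^m are row
   spaces of square matrices, and linear maps F_2^n -> F_2^m are n x m matrices
   acting on row vectors on the right. *)

Definition is_matroid (m : nat) (M : {set 'rV['F_2]_m}) : bool := 0 \notin M.

Definition linmap (n m : nat) (A : 'M['F_2]_(n, m)) (v : 'rV['F_2]_n) :
  'rV['F_2]_m := v *m A.

Definition subspace (m : nat) (U : 'M['F_2]_m) : {set 'rV['F_2]_m} :=
  [set v : 'rV['F_2]_m | (v <= U)%MS].

(* When 0 \notin M the zero subspace, of codimension m, is disjoint from M, so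
   the default value m of the minimum is one of the values minimized. *)
Definition critical_number (m : nat) (M : {set 'rV['F_2]_m}) : nat :=
  \big[minn/m]_(U : 'M['F_2]_m | [disjoint subspace U & M]) (m - \rank U)%N.

Definition is_restriction (n m : nat) (N : {set 'rV['F_2]_n})
    (M S : {set 'rV['F_2]_m}) : bool :=
  (S \subset M) &&
  [exists A : 'M['F_2]_(n, m),
     injectiveb (linmap A) && (S == [set linmap A v | v in N])].

Definition is_free (n m : nat) (N : {set 'rV['F_2]_n})
    (M : {set 'rV['F_2]_m}) : bool :=
  ~~ [exists S : {set 'rV['F_2]_m}, is_restriction N M S].

Definition isomorphic (n m : nat) (N : {set 'rV['F_2]_n})
    (M : {set 'rV['F_2]_m}) : Prop :=
  exists2 A : 'M['F_2]_(n, m),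
    bijective (linmap A) & [set linmap A v | v in N] = M.

(* The maximum over an empty family is 0; the family contains the empty matroid
   as soon as N is nonempty. *)
Definition ex_number (m : nat) (N : {set 'rV['F_2]_m}) (n : nat) : nat :=
  \max_(M : {set 'rV['F_2]_n} | is_matroid M && is_free N M) #|M|.

(* bose_burton n t is BB(n-1,2,t), indexed by its dimension n rather than by the
   projective dimension n - 1; the (n-t)-dimensional subspace removed is the
   span of the first n - t unit vectors. *)
Definition bose_burton (n t : nat) : {set 'rV['F_2]_n} :=
  ~: subspace (pid_mx (n - t)).

(* Main.v *)
Require Import Defs.
From mathcomp Require Import all_boot all_order all_algebra.
From mathcomp Require Import zify.

Set Implicit Arguments.
Unset Strict Implicit.
Unset Printing Implicit Defensive.

Import GRing.Theory Num.Theory.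
Local Open Scope ring_scope.

(* Put t = chi(N) - 1 and let C be the complement of an N-free M with
   |C| <= 2^(n-t).  Deleting e from N leaves a subset of the complement of a
   subspace of codimension t containing e; so N is contained in a Bose-Burton
   geometry with one extra point e.

   Density: over F_2 a set of positive density contains affine flats of every
   fixed dimension (shift it repeatedly along popular differences).  Applying
   this t times, each time to the intersection of 2^j translates of a set whose
   complement has density below 2^(1-t), produces a large Bose-Burton geometry
   with parameter t inside that set.

   Stability: for e' in M, a Bose-Burton geometry inside M and its translate by
   e' would, together with e', contain N.  Hence C and C + e' are almost
   disjoint for every e' outside C, while |C| is almost 2^(n-t).  Double
   counting then shows that most x in C almost stabilise C; sums of two such x
   lie in C and form a subspace with more than 2^(n-t-1) elements, so it is all
   of C. *)

(** * Row vectors over ['F_2] *)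

Lemma F2_cases (c : 'F_2) : (c = 0) + (c = 1).
Proof. by case: c => [[|[|//]]] lt2; [left | right]; apply: val_inj. Qed.

Lemma addrr_F2 n (v : 'rV['F_2]_n) : v + v = 0.
Proof.
by apply/rowP=> i; rewrite !mxE; case: (F2_cases (v 0 i)) => ->; apply: val_inj.
Qed.

Lemma addrK_F2 n (v : 'rV['F_2]_n) : involutive (+%R^~ v).
Proof. by move=> x /=; rewrite -addrA addrr_F2 addr0. Qed.

Lemma addKr_F2 n (v : 'rV['F_2]_n) : involutive (+%R v).
Proof. by move=> x /=; rewrite addrA addrr_F2 add0r. Qed.

Lemma card_F2rV n : #|{: 'rV['F_2]_n}| = (2 ^ n)%N.
Proof. by rewrite card_mx card_Fp // mul1n. Qed.

Lemma row_free_inj_rV d n (W : 'M['F_2]_(d, n)) :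
  row_free W -> injective (fun b : 'rV_d => b *m W).
Proof. by move=> fW b b'; apply: row_free_inj. Qed.

Lemma card_rowspace d n (W : 'M['F_2]_(d, n)) :
  row_free W -> #|[set v : 'rV_n | (v <= W)%MS]| = (2 ^ d)%N.
Proof.
move=> fW; rewrite -card_F2rV -(card_imset _ (row_free_inj_rV fW)).
apply: eq_card => v; rewrite inE; apply/idP/imsetP.
  by case/submxP => b ->; exists b.
by case=> b _ ->; apply: submxMl.
Qed.

Lemma card_subspace n (U : 'M['F_2]_n) : #|subspace U| = (2 ^ \rank U)%N.
Proof.
rewrite -(card_rowspace (row_base_free U)).
by apply: eq_card => v; rewrite !inE eq_row_base.
Qed.

Lemma mul_row_cons d n (b : 'rV['F_2]_(1 + d)) (w : 'rV['F_2]_n)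
    (W : 'M['F_2]_(d, n)) :
  b *m col_mx w W = lsubmx b 0 0 *: w + rsubmx b *m W.
Proof.
by rewrite -{1}[b]hsubmxK mul_row_col {1}[lsubmx b]mx11_scalar mul_scalar_mx.
Qed.

Lemma row_free_cons d n (w : 'rV['F_2]_n) (W : 'M['F_2]_(d, n)) :
  row_free W -> ~~ (w <= W)%MS -> row_free (col_mx w W).
Proof.
move=> fW wW; apply: inj_row_free => v.
rewrite mul_row_cons; case: (F2_cases (lsubmx v 0 0)) => v0; rewrite v0.
  rewrite scale0r add0r => /eqP; rewrite mulmx_free_eq0 // => /eqP v1.
  by rewrite -[v]hsubmxK [lsubmx v]mx11_scalar v0 v1 raddf0 row_mx0.
rewrite scale1r => /(congr1 (+%R w)); rewrite addKr_F2 addr0 => wE.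
by case/negP: wW; rewrite -wE submxMl.
Qed.

(** * Popular shifts and large structures in dense sets *)

Definition overlap n (D : {set 'rV['F_2]_n}) (w : 'rV['F_2]_n) : nat :=
  #|[set x in D | x + w \in D]|.

Lemma sum_overlap n (D : {set 'rV['F_2]_n}) :
  (\sum_w overlap D w = #|D| * #|D|)%N.
Proof.
under eq_bigr => w _.
  rewrite /overlap -sum1_card big_mkcond /=.
  under eq_bigr => x _ do rewrite inE.
  over.
rewrite exchange_big /= -sum_nat_const [RHS]big_mkcond /=.
apply: eq_bigr => x _; case: ifP => xD /=; last by rewrite big1.
rewrite -big_mkcond sum1_card -(card_imset _ (can_inj (addKr_F2 x))) /=.
apply: eq_card => w; apply/imsetP/idP => [[y yD ->]|wD]; first exact: yD.
by exists (x + w); rewrite ?unfold_in /= addKr_F2.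
Qed.

Lemma overlap_le n (D : {set 'rV['F_2]_n}) w : (overlap D w <= #|D|)%N.
Proof.
by apply: subset_leq_card; apply/subsetP => x; rewrite inE => /andP[].
Qed.

Lemma sum_bound_in (T : finType) (A : {set T}) (f : T -> nat) k :
  (forall x, x \in A -> f x <= k)%N -> (\sum_(x in A) f x <= #|A| * k)%N.
Proof. by move=> fk; rewrite -sum_nat_const; apply: leq_sum. Qed.

(** Averaging: in [sum_overlap] the shifts in [F] account for at most half of the total, so the
    other shifts, at most [2 ^ n] of them, share at least half. *)
Lemma popular_shift n (D F : {set 'rV['F_2]_n}) :
  (2 * #|F| <= #|D|)%N -> (0 < #|D|)%N ->
  exists2 w, w \notin F & (#|D| * #|D| <= 2 * 2 ^ n * overlap D w)%N.
Proof.
move=> leFD D0.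
case: (pickP [pred w | (w \notin F) &&
                (#|D| * #|D| <= 2 * 2 ^ n * overlap D w)%N]).
  by move=> w /= /andP[wF le]; exists w.
move=> none; exfalso.
have bF : (\sum_(w in F) overlap D w <= #|F| * #|D|)%N.
  by apply: sum_bound_in => w _; apply: overlap_le.
(* The [+ 1] encodes strict failure of the bound; it forces [~: F] to be empty, against
   [2 * #|F| <= #|D|]. *)
have bC : (\sum_(w in ~: F) (2 * 2 ^ n * overlap D w + 1) <=
           #|~: F| * (#|D| * #|D|))%N.
  apply: sum_bound_in => w; rewrite inE => wF.
  by move: (none w); rewrite /= wF /= => /negbT; rewrite -ltnNge addn1.
have := sum_overlap D; rewrite (bigID (mem F)) /=.
move: bC; rewrite big_split /= -big_distrr /= sum1_card.
under eq_bigl => w do rewrite inE.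
set s := (\sum_(i | i \notin F) _)%N; set s' := (\sum_(i in F) _)%N in bF *.
have := cardsC F; rewrite card_F2rV.
have : (#|D| <= 2 ^ n)%N by rewrite -card_F2rV max_card.
have : (0 < 2 ^ n)%N by rewrite expn_gt0.
move: (2 ^ n)%N s s' bF => V s s' bF V0 DV FV bC sE.
have h1 : (2 * #|F| * #|D| <= #|D| * #|D|)%N by rewrite leq_mul2r leFD orbT.
have h2 : (#|D| * #|D| <= 2 * s)%N.
  by move: bF h1 sE; rewrite -(mulnA 2%N #|F|);
    move: (#|F| * _)%N (#|D| * _)%N; lia.
have h3 : (V * (#|D| * #|D|) <= V * (2 * s))%N by rewrite leq_mul2l h2 orbT.
have h4 : (#|~: F| * (#|D| * #|D|) <= V * (#|D| * #|D|))%N.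
  by rewrite leq_mul2r -FV leq_addl orbT.
have : #|~: F| = 0%N.
  move: bC h3 h4; rewrite -(mulnA 2%N V) (mulnCA 2%N V).
  move: (V * (2 * s))%N (V * (#|D| * #|D|))%N (#|~: F| * (#|D| * #|D|))%N.
  by move: #|~: F|; lia.
by move: leFD DV; rewrite -FV => leFD DV; lia.
Qed.

Definition flat_bases d n (D : {set 'rV['F_2]_n}) (W : 'M['F_2]_(d, n)) :
  {set 'rV['F_2]_n} := [set x | [forall b : 'rV_d, x + b *m W \in D]].

Lemma flat_directions p d : exists q n0 : nat, forall n, (n0 <= n)%N ->
  forall D : {set 'rV['F_2]_n}, (2 ^ n <= 2 ^ p * #|D|)%N ->
  exists2 W : 'M['F_2]_(d, n), row_free W &
    (2 ^ n <= 2 ^ q * #|flat_bases D W|)%N.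
Proof.
elim: d => [|d [q [n0 IH]]].
  exists p, 0%N => n _ D hD; exists 0; first by rewrite /row_free mxrank0.
  apply: leq_trans hD _; rewrite leq_mul2l; apply/orP; right.
  apply: subset_leq_card; apply/subsetP => x xD; rewrite inE.
  by apply/forallP => b; rewrite mulmx0 addr0.
(* A popular shift squares the density [2^-q] and halves it; [q + d + 1] makes the row space at most
   half of [D']. *)
exists (2 * q + 1)%N, (maxn n0 (q + d + 1)) => n.
rewrite geq_max => /andP[le0 leq] D /(IH n le0 D)[W fW].
set D' := flat_bases D W => hD'.
have cW := card_rowspace fW.
have D'0 : (0 < #|D'|)%N by have := expn_gt0 2 n; nia.
have leWD : (2 * #|[set v : 'rV_n | (v <= W)%MS]| <= #|D'|)%N.
  rewrite cW -expnS -(leq_pmul2l (expn_gt0 2 q)) -expnD.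
  by apply: leq_trans hD'; rewrite leq_exp2l //; lia.
have [w] := popular_shift leWD D'0; rewrite inE => wW hw.
exists (col_mx w W); first exact: row_free_cons.
apply: (@leq_trans (2 ^ (2 * q + 1) * overlap D' w)%N).
  rewrite -(leq_pmul2l (expn_gt0 2 n)) expnD mul2n -addnn expnD expn1.
  by move: hw hD'; move: (2 ^ n)%N (2 ^ q)%N => V K; nia.
rewrite leq_mul2l; apply/orP; right; apply: subset_leq_card.
apply/subsetP => x; rewrite !inE => /andP[/forallP xD /forallP xwD].
apply/forallP => b; have -> := mul_row_cons b w W.
case: (F2_cases (@lsubmx _ 1 1 d b 0 0)) => ->; first by rewrite scale0r add0r.
by rewrite scale1r addrA.
Qed.

(** Some translate of the row space of [W0] meets [D] in density at least [2^-p], by averaging, and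
    [flat_directions] applies inside it. *)
Lemma affine_flat_in p d : exists r0 : nat, forall n r (W0 : 'M['F_2]_(r, n)),
  (r0 <= r)%N -> row_free W0 ->
  forall D : {set 'rV['F_2]_n}, (2 ^ n <= 2 ^ p * #|D|)%N ->
  exists x, exists W : 'M['F_2]_(d, n),
    [/\ row_free W, (W <= W0)%MS & forall b, x + b *m W \in D].
Proof.
have [q [n0 flat]] := flat_directions p d.
exists n0 => n r W0 ler fW0 D hD.
pose slice y := [set u : 'rV['F_2]_r | y + u *m W0 \in D].
have sumS : (\sum_y #|slice y| = 2 ^ r * #|D|)%N.
  under eq_bigr => y _.
    rewrite -sum1_card big_mkcond /=.
    under eq_bigr => u _ do rewrite inE.
    over.
  rewrite exchange_big /= -card_F2rV -sum_nat_const; apply: eq_bigr => u _.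
  rewrite -big_mkcond sum1_card.
  rewrite -(card_imset _ (can_inj (addrK_F2 (u *m W0)))) /=.
  apply: eq_card => y; apply/imsetP/idP => [[z zD ->]|yD]; first exact: zD.
  by exists (y + u *m W0); rewrite ?unfold_in /= addrK_F2.
have [y hy] : exists y, (2 ^ r <= 2 ^ p * #|slice y|)%N.
  case: (pickP (fun y => 2 ^ r <= 2 ^ p * #|slice y|)%N) => [y hy|none].
    by exists y.
  have : (\sum_(y in [set: 'rV['F_2]_n]) (2 ^ p * #|slice y| + 1) <=
          #|[set: 'rV['F_2]_n]| * 2 ^ r)%N.
    by apply: sum_bound_in => y _; rewrite addn1 ltnNge none.
  rewrite big_split /= sum1_card cardsT card_F2rV -big_distrr /=.
  under eq_bigl => y do rewrite inE.
  rewrite sumS; have := expn_gt0 2 n; move: hD.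
  by move: (2 ^ n)%N (2 ^ p)%N (2 ^ r)%N => V P K; nia.
have [W fW] := flat r ler _ hy.
set E := flat_bases _ W => hE.
have /set0Pn[x] : E != set0.
  by apply: contraTneq hE => ->; rewrite cards0 muln0 -ltnNge expn_gt0.
rewrite inE => /forallP xE.
exists (y + x *m W0), (W *m W0); split; last 1 first.
- by move=> b; move: (xE b); rewrite inE mulmxDl mulmxA addrA.
- apply: inj_row_free => v; rewrite mulmxA => /eqP.
  by rewrite mulmx_free_eq0 // mulmx_free_eq0 // => /eqP.
- exact: submxMl.
Qed.

(** The numerical hypothesis bounds the density of [~: M] by [2^(1-t) * (1 - 2^-p)]. Each induction
    step adds to [X] the base point of a flat with directions inside the row space found before. *)
Lemma bose_burton_density p t d : exists r0 : nat,
  forall n r (W0 : 'M['F_2]_(r, n)), (r0 <= r)%N -> row_free W0 ->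
  forall M : {set 'rV['F_2]_n},
  (2 ^ p * (2 ^ t * #|~: M|) + 2 * 2 ^ n <= 2 * (2 ^ p * 2 ^ n))%N ->
  exists X : 'M['F_2]_(t, n), exists W : 'M['F_2]_(d, n),
    [/\ row_free W, (W <= W0)%MS &
        forall a b, a != 0 -> a *m X + b *m W \in M].
Proof.
elim: t d => [|t IH] d.
  exists d => n r W0 dr fW0 M _; exists 0, (pid_mx d *m W0).
  split; last by move=> a b; rewrite (thinmx0 a) eqxx.
    apply: inj_row_free => v; rewrite mulmxA => /eqP.
    rewrite mulmx_free_eq0 // mulmx_free_eq0 => [/eqP //|].
    by rewrite /row_free rank_pid_mx.
  exact: submxMl.
have [d' flat] := affine_flat_in p d; have [r0 {}IH] := IH d'.
exists r0 => n r W0 ler fW0 M; rewrite expnS => hM.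
have [|X [W' [fW' W'W0 XM]]] := IH n r W0 ler fW0 M.
  move: hM; rewrite -(mulnA 2%N) mulnCA.
  by move: (2 ^ p * (2 ^ t * #|~: M|))%N (2 ^ p * 2 ^ n)%N (2 ^ n)%N; lia.
(* An intersection of translates of [M] by the span of [X]; the density hypothesis leaves it density
   at least [2^-p]. *)
pose D := [set y : 'rV['F_2]_n | [forall a : 'rV_t, y + a *m X \in M]].
have cD : (#|~: D| <= 2 ^ t * #|~: M|)%N.
  rewrite mulnC -card_F2rV -cardsT -cardsX.
  apply: leq_trans (leq_imset_card (fun ca : _ * _ => ca.1 + ca.2 *m X) _).
  apply: subset_leq_card; apply/subsetP => y; rewrite !inE negb_forall.
  case/existsP => a ya; apply/imsetP; exists (y + a *m X, a).
    by rewrite !inE ya.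
  by rewrite /= addrK_F2.
have hD : (2 ^ n <= 2 ^ p * #|D|)%N.
  have cDD := cardsC D; rewrite card_F2rV in cDD.
  have : (2 ^ p * #|~: D| <= 2 ^ p * (2 ^ t * #|~: M|))%N.
    by rewrite leq_mul2l cD orbT.
  move: hM; rewrite -(mulnA 2%N) mulnCA -cDD (mulnDr (2 ^ p)%N).
  move: (2 ^ p * (2 ^ t * #|~: M|))%N (2 ^ p * #|D|)%N (2 ^ p * #|~: D|)%N.
  by move: #|D| #|~: D|; lia.
have [x [W [fW WW' xD]]] := flat n d' W' (leqnn _) fW' D hD.
exists (col_mx x X), W; split=> //; first exact: submx_trans WW' W'W0.
move=> a b a0; have -> := mul_row_cons a x X.
case: (F2_cases (@lsubmx _ 1 1 t a 0 0)) => aE; rewrite aE.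
  have /submxP[Z ->] := WW'; rewrite scale0r add0r mulmxA; apply: XM.
  apply: contraNneq a0 => a1; apply/eqP.
  by rewrite -[a](@hsubmxK _ 1 1 t) a1 [lsubmx _]mx11_scalar aE raddf0 row_mx0.
rewrite scale1r addrAC.
by move: (xD b); rewrite inE => /forallP.
Qed.

(** * Embedding [N] by means of a Bose-Burton geometry and one extra point *)

Lemma row_free_complement n (e : 'rV['F_2]_n) : e != 0 ->
  exists W0 : 'M['F_2]_(n.-1, n), row_free W0 /\ ~~ (e <= W0)%MS.
Proof.
case: n e => [|n] e; first by rewrite (thinmx0 e) eqxx.
move=> e0; have [i ei] : exists i, e 0 i != 0.
  apply/existsP; apply: contraNT e0; rewrite negb_exists => /forallP e0.
  by apply/eqP/rowP => i; rewrite mxE; apply/eqP; move: (e0 i); rewrite negbK.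
pose W0 : 'M['F_2]_(n, n.+1) := rowsub (lift i) 1%:M.
exists W0; split.
  apply: inj_row_free => v vW; apply/rowP => j.
  move/rowP/(_ (lift i j)): vW; rewrite !mxE (bigD1 j) //= big1 => [|k kj].
    by rewrite !mxE eqxx mulr1 addr0.
  by rewrite !mxE (inj_eq lift_inj) (negPf kj) mulr0.
apply: contraNN ei => /submxP[b ->]; rewrite mxE big1 // => k _.
by rewrite !mxE eq_sym (negPf (neq_lift i k)) mulr0.
Qed.

(* The functional [f] below is [1] at [e], so [x |-> x + f x *: e] kills [e];
   [A] sends [e] to [e'] and every vector outside the kernel of [P] to a vector
   of the Bose-Burton geometry spanned by [X] and [W], up to adding [e']. *)
Lemma embed_bose_burton m n t (N : {set 'rV['F_2]_m}) (M : {set 'rV['F_2]_n})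
    (P : 'M['F_2]_(m, t)) (e : 'rV['F_2]_m) (e' : 'rV['F_2]_n)
    (X : 'M['F_2]_(t, n)) (W : 'M['F_2]_(m, n)) :
  e != 0 -> e *m P = 0 -> (forall v, v \in N :\ e -> v *m P != 0) ->
  is_matroid M -> e' \in M -> row_free W -> ~~ (e' <= W)%MS ->
  (forall a b, a != 0 -> a *m X + b *m W \in [set x in M | x + e' \in M]) ->
  ~~ is_free N M.
Proof.
move=> e0 eP NP M0 e'M fW e'W XM.
have [i ei] : exists i, e 0 i = 1.
  case: (pickP (fun i => e 0 i == 1)) => [i /eqP ei|none]; first by exists i.
  case/eqP: e0; apply/rowP => i; rewrite mxE; move: (none i).
  by case: (F2_cases (e 0 i)) => -> //; rewrite eqxx.
pose f : 'cV['F_2]_m := delta_mx i 0.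
have fE v : v *m f = (v 0 i)%:M.
  rewrite [LHS]mx11_scalar mxE (bigD1 i) //= big1 => [|k ki].
    by rewrite mxE !eqxx mulr1 addr0.
  by rewrite mxE (negPf ki) mulr0.
pose A := P *m X + (1%:M + f *m e) *m W + f *m e'.
have AE v : v *m A = v *m P *m X + (v + v 0 i *: e) *m W + v 0 i *: e'.
  by rewrite !mulmxDr !mulmxA mulmxDr mulmx1 mulmxA fE !mul_scalar_mx.
have AP v : v *m P != 0 -> v *m A \in M.
  move=> vP; rewrite AE; move: (XM _ (v + v 0 i *: e) vP); rewrite inE.
  case/andP; case: (F2_cases (v 0 i)) => ->;
    by rewrite ?scale0r ?scale1r ?addr0.
rewrite negbK; apply/existsP; exists [set linmap A v | v in N].
apply/andP; split.
  apply/subsetP => _ /imsetP[v vN ->]; have [->|ve] := eqVneq v e.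
    by rewrite /linmap AE eP ei scale1r addrr_F2 !mul0mx !add0r scale1r.
  by apply/AP/NP; rewrite !inE ve.
apply/existsP; exists A; rewrite eqxx andbT; apply/injectiveP.
(* Off the kernel of [P] the image lies in [M], which omits 0; on the kernel, [W] is injective and
   [e'] is outside its row space. *)
have kA (v : 'rV_m) : v *m A = 0 -> v = 0.
  have [vP|vP vA] := eqVneq (v *m P) 0; last first.
    by move: M0 (AP v vP); rewrite /is_matroid vA => /negPf ->.
  rewrite AE vP mul0mx add0r.
  case: (F2_cases (v 0 i)) => ->.
    by rewrite !scale0r !addr0 => /eqP; rewrite mulmx_free_eq0 // => /eqP.
  rewrite !scale1r => /(congr1 (+%R^~ e')); rewrite addrK_F2 add0r => e'E.
  by case/negP: e'W; rewrite -e'E submxMl.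
move=> v w; rewrite /linmap => /eqP; rewrite -subr_eq0 -mulmxBl.
by move/eqP/kA/eqP; rewrite subr_eq0 => /eqP.
Qed.

(** Otherwise [bose_burton_density] applies to the intersection of [M] with its translate by [e'],
    and [embed_bose_burton] finds [N] in [M]. *)
Lemma free_union_large m t (N : {set 'rV['F_2]_m}) (P : 'M['F_2]_(m, t))
    (e : 'rV['F_2]_m) p :
  e != 0 -> e *m P = 0 -> (forall v, v \in N :\ e -> v *m P != 0) ->
  exists n0 : nat, forall n, (n0 <= n)%N -> forall M : {set 'rV['F_2]_n},
    is_matroid M -> is_free N M -> forall e', e' \in M ->
    (2 * (2 ^ p * 2 ^ n) <
       2 ^ p * (2 ^ t * #|~: [set x in M | (x + e')%R \in M]|) + 2 * 2 ^ n)%N.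
Proof.
move=> e0 eP NP; have [r0 dens] := bose_burton_density p t m.
exists r0.+1 => n len M M0 fM e' e'M; rewrite ltnNge; apply/negP => small.
have e'0 : e' != 0 by apply: contraNneq M0 => <-.
(* Directions chosen in a hyperplane missing [e'] stay independent of [e']; its dimension [n.-1]
   explains [r0.+1]. *)
have [W0 [fW0 e'W0]] := row_free_complement e'0.
have lr : (r0 <= n.-1)%N by lia.
have [X [W [fW WW0 XM]]] := dens n _ W0 lr fW0 _ small.
have e'W : ~~ (e' <= W)%MS by apply: contraNN e'W0 => /submx_trans; apply.
by have := embed_bose_burton e0 eP NP M0 e'M fW e'W XM; rewrite fM.
Qed.

(** * Stability: sets that are almost subspaces *)

Lemma closed_is_subspace n (D : {set 'rV['F_2]_n}) :
  0 \in D -> (forall x y, x \in D -> y \in D -> x + y \in D) ->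
  exists U : 'M['F_2]_n, D = subspace U.
Proof.
move=> D0 Dadd; pose U := (\sum_(v in D) <<v>>)%MS; exists U.
apply/setP => x; rewrite inE; apply/idP/idP => [xD|].
  by rewrite (sumsmx_sup x) // genmxE.
case/sub_sumsmxP => u ->; apply: (big_ind (fun x => x \in D)) => // v vD.
have /sub_rVP[c ->] : (u v *m <<v>> <= v)%MS by rewrite -(genmxE v) submxMl.
by case: (F2_cases c) => ->; rewrite ?scale0r ?scale1r.
Qed.

(** Half the size of the symmetric difference of [C] and its translate by [x]. *)
Definition defect n (C : {set 'rV['F_2]_n}) (x : 'rV['F_2]_n) : nat :=
  #|[set y in C | y + x \notin C]|.

Lemma overlap_defect n (C : {set 'rV['F_2]_n}) x :
  (overlap C x + defect C x = #|C|)%N.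
Proof.
rewrite -(cardsID [set y | y + x \in C] C); congr (_ + _)%N.
  by apply: eq_card => y; rewrite !inE.
by apply: eq_card => y; rewrite !inE andbC.
Qed.

Lemma defectD n (C : {set 'rV['F_2]_n}) x y :
  (defect C (x + y)%R <= defect C x + defect C y)%N.
Proof.
rewrite -(card_imset _ (can_inj (addrK_F2 x)) : _ = defect C y).
apply: leq_trans (leq_card_setU _ _); apply: subset_leq_card.
apply/subsetP => z; rewrite !inE addrA => /andP[zC zxy].
rewrite zC /=; case: (boolP (z + x \in C)) => //= zx.
by apply/imsetP; exists (z + x); rewrite ?addrK_F2 // inE zx.
Qed.

Lemma set_stability n t (C : {set 'rV['F_2]_n}) : (t <= n)%N ->
  0 \in C -> (#|C| <= 2 ^ (n - t))%N ->
  (15 * 2 ^ (n - t) <= 16 * #|C|)%N ->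
  (forall e, e \notin C -> 256 * 2 ^ t * overlap C e <= 2 ^ (n - t))%N ->
  exists2 U : 'M['F_2]_n, C = subspace U & \rank U = (n - t)%N.
Proof.
move=> tn C0 Cle Cge small.
have Q0 : (0 < 2 ^ (n - t))%N by rewrite expn_gt0.
have QV : (2 ^ n = 2 ^ t * 2 ^ (n - t))%N by rewrite -expnD subnKC.
set Q := (2 ^ (n - t))%N in Cle Cge small Q0 QV.
pose d := defect C.
have dD x y : (d (x + y)%R <= d x + d y)%N by apply: defectD.
(* Outside [C] the defect is at least [15Q/16 - Q/256]. The 3 allows for sums of three elements of
   defect at most [Q/16]. *)
have dC x : (16 * d x <= 3 * Q)%N -> x \in C.
  move=> dx; apply: contraLR dx => /small; rewrite -ltnNge.
  have := overlap_defect C x; have := expn_gt0 2 t; rewrite -/(d x) -mulnA.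
  move: #|C| (overlap C x) (d x) Cge => c o b; move: (2 ^ t)%N => K Cge K0 odc.
  have : (o <= K * o)%N by rewrite leq_pmull.
  by move: (K * o)%N; lia.
(* Adding the overlaps over [C] to either side gives [#|C| * #|C|]. *)
have sum_in : (\sum_(e in C) d e = \sum_(e in ~: C) overlap C e)%N.
  have := sum_overlap C; rewrite (bigID (mem C)) /= => sE.
  have : (\sum_(e in C) d e + \sum_(e in C) overlap C e = #|C| * #|C|)%N.
    rewrite -big_split -sum_nat_const; apply: eq_bigr => e _.
    by rewrite /= addnC overlap_defect.
  rewrite -sE addnC => /addnI ->.
  by apply: eq_bigl => e; rewrite inE.
have sum_le : (256 * \sum_(e in C) d e <= Q * Q)%N.
  rewrite sum_in -(leq_pmul2l (expn_gt0 2 t)).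
  have : (\sum_(e in ~: C) 256 * 2 ^ t * overlap C e <= #|~: C| * Q)%N.
    by apply: sum_bound_in => e; rewrite inE => /small.
  rewrite -big_distrr /= mulnA (mulnC _ 256%N) => /leq_trans; apply.
  rewrite mulnA -QV leq_mul2r; apply/orP; right.
  by rewrite -card_F2rV max_card.
(* [T] is the set of near-stabilisers: by [sum_le] and Markov's inequality it is
   almost all of [C], and by [dD] and [dC] any three of its elements sum into
   [C]; then [D] = [T] + [T] is closed under addition since two translates of
   [T] inside [C] must meet. *)
pose T := [set e in C | (16 * d e <= Q)%N].
have TC x : x \in T -> (16 * d x <= Q)%N by rewrite inE => /andP[].
(* As 256 = 16 * 16, [sum_le] leaves at most [Q/16] elements of [C] outside [T]. *)
have T_large : (16 * #|C| <= 16 * #|T| + Q)%N.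
  have cT : (#|T| + #|C :\: T| = #|C|)%N.
    rewrite -(cardsID T C); congr (#|(_ : {set _})| + _)%N.
    by apply/setP => x; rewrite !inE; case: (x \in C).
  have : (\sum_(e in C :\: T) Q <= \sum_(e in C) 16 * d e)%N.
    rewrite [leqRHS](big_setID T) /=.
    apply: leq_trans (leq_addl _ _); apply: leq_sum => e.
    by rewrite !inE negb_and => /andP[/orP[/negPf->//|]]; lia.
  rewrite sum_nat_const -big_distrr /=.
  move: sum_le cT; move: (\sum_(e in C) _)%N #|T| #|C| #|C :\: T| => S a b c.
  by nia.
pose D := [set z : 'rV['F_2]_n | [exists x in T, (z + x) \in T]].
have memD z : reflect (exists2 x, x \in T & z + x \in T) (z \in D).
  by rewrite inE; apply: (iffP exists_inP).
have T0 : 0 \in T.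
  rewrite inE C0 /= /d /defect.
  suff -> : [set y in C | y + 0 \notin C] = set0 by rewrite cards0.
  by apply/setP => x; rewrite !inE addr0 andbN.
have TD x : x \in T -> x \in D.
  by move=> xT; apply/memD; exists 0; rewrite ?addr0.
have DE z : z \in D -> (16 * d z <= 2 * Q)%N.
  case/memD => x /TC dx /TC dzx; have := dD (z + x) x; rewrite addrK_F2.
  by move: (d _) (d _) (d _) dx dzx; lia.
have Dadd a b : a \in D -> b \in D -> a + b \in D.
  move=> aD bD.
  pose Tr (c : 'rV['F_2]_n) : {set 'rV['F_2]_n} := [set x + c | x in T].
  have shift c : c \in D -> Tr c \subset C.
    move=> cD; apply/subsetP => _ /imsetP[x xT ->]; apply: dC.
    by have := dD x c; have := DE _ cD; have := TC _ xT;
    by move: (d _) (d _) (d _); lia.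
  have shift_card c : #|Tr c| = #|T|.
    by rewrite card_imset //; apply: can_inj (addrK_F2 c).
  have /set0Pn[z] : Tr a :&: Tr b != set0.
    apply/eqP => disj.
    have := cardsUI (Tr a) (Tr b).
    rewrite disj cards0 addn0 !shift_card.
    have : (#|Tr a :|: Tr b| <= #|C|)%N.
      by apply: subset_leq_card; rewrite subUset !shift.
    by move: #|_ :|: _| #|T| #|C| T_large Cle Cge; lia.
  rewrite inE => /andP[/imsetP[x xT zx] /imsetP[y yT zy]].
  apply/memD; exists x => //.
  suff -> : a + b + x = y by [].
  by rewrite addrAC (addrC a) -zx zy addrK_F2.
have [U DU] := closed_is_subspace (TD _ T0) Dadd.
have DC : D \subset C.
  by apply/subsetP => z /DE dz; apply: dC; lia.
have cDle := subset_leq_card DC.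
have cDge : (#|T| <= #|D|)%N by apply/subset_leq_card/subsetP.
(* [#|D|] is a power of two, at most [Q] and, because of [T], more than [Q/2]. *)
have rU : \rank U = (n - t)%N.
  apply/eqP; rewrite eqn_leq -(leq_exp2l _ _ (ltnSn 1)) -card_subspace -DU.
  rewrite (leq_trans cDle) //= -ltnS -(ltn_exp2l _ _ (ltnSn 1)) expnS.
  rewrite -card_subspace -DU -/Q.
  by move: #|D| #|T| #|C| T_large Cle Cge cDge; lia.
exists U => //; rewrite -DU; apply/esym/eqP; rewrite eqEcard DC /=.
by rewrite DU card_subspace rU.
Qed.

(** * Critical number and Bose-Burton geometries *)

Lemma bigmin_le (I : eqType) (r : seq I) (P : pred I) (F : I -> nat) k i :
  i \in r -> P i -> (\big[minn/k]_(j <- r | P j) F j <= F i)%N.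
Proof.
elim: r => // j r IH; rewrite inE big_cons => /predU1P[<- ->|ir Pi].
  exact: geq_minl.
by case: (P j); rewrite ?(leq_trans (geq_minr _ _)) // IH.
Qed.

(** The kernel of [P] is disjoint from [N] and has codimension at most [t]. *)
Lemma critical_number_le m t (N : {set 'rV['F_2]_m}) (P : 'M['F_2]_(m, t)) :
  (forall v, v \in N -> v *m P != 0) -> (critical_number N <= t)%N.
Proof.
move=> NP; apply: (@leq_trans (m - \rank (kermx P))).
  apply: bigmin_le; first exact: mem_index_enum.
  apply/pred0P => v; rewrite /= !inE; apply/negP => /andP[/sub_kermxP vP vN].
  by case/eqP: (NP v vN).
by rewrite mxrank_ker subKn ?rank_leq_row ?rank_leq_col.
Qed.

(** Take the quotient by a subspace attaining the minimum, padded with zero columns to width [t]. *)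
Lemma critical_number_map m t (N : {set 'rV['F_2]_m}) :
  is_matroid N -> (critical_number N <= t)%N ->
  exists P : 'M['F_2]_(m, t), forall v, v \in N -> v *m P != 0.
Proof.
move=> N0.
have [U dU ->] : exists2 U : 'M['F_2]_m, [disjoint subspace U & N] &
    critical_number N = (m - \rank U)%N.
  apply: (big_rec (fun c => exists2 U : 'M['F_2]_m,
    [disjoint subspace U & N] & c = (m - \rank U)%N)) => [|U c dU [U' dU' ->]].
    exists 0; last by rewrite mxrank0 subn0.
    apply/pred0P => v; rewrite /= !inE submx0.
    by apply/negP => /andP[/eqP -> v0]; rewrite /is_matroid v0 in N0.
  by rewrite /minn; case: ifP => _; [exists U | exists U'].
rewrite -mxrank_coker => le_t.
have fP : row_free (pid_mx (\rank (cokermx U)) :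
                    'M['F_2]_(\rank (cokermx U), t)).
  by rewrite /row_free rank_pid_mx.
exists (col_base (cokermx U) *m pid_mx (\rank (cokermx U))) => v vN.
apply/eqP => vP; have /pred0P/(_ v) := dU; rewrite /= vN andbT inE.
rewrite submxE -(mulmx_base (cokermx U)) mulmxA.
suff -> : v *m col_base (cokermx U) = 0 by rewrite mul0mx eqxx.
by apply/eqP; rewrite -(mulmx_free_eq0 _ fP) -mulmxA vP.
Qed.

Lemma mem_bose_burton n t (v : 'rV['F_2]_n) :
  (v \in bose_burton n t) = ~~ (v <= (pid_mx (n - t) : 'M_n))%MS.
Proof. by rewrite !inE. Qed.

Lemma card_bose_burton n t : (t <= n)%N ->
  #|bose_burton n t| = (2 ^ n - 2 ^ (n - t))%N.
Proof.
move=> tn; have := cardsC (subspace (pid_mx (n - t) : 'M['F_2]_n)).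
rewrite card_F2rV card_subspace rank_pid_mx ?leq_subr //.
by rewrite /bose_burton => <-; rewrite addKn.
Qed.

(** An embedding followed by the quotient by the removed subspace, of rank [t], is nonzero on [N],
    so [critical_number_le] applies. *)
Lemma bose_burton_free m n t (N : {set 'rV['F_2]_m}) : (t <= n)%N ->
  (t < critical_number N)%N -> is_free N (bose_burton n t).
Proof.
move=> tn; rewrite ltnNge; apply: contraNN => /existsP[S /andP[SB]].
case/existsP => A /andP[_ /eqP SE].
pose K := cokermx (pid_mx (n - t) : 'M['F_2]_n).
have rK : \rank K = t by rewrite mxrank_coker rank_pid_mx ?leq_subr // subKn.
rewrite -rK; apply: (@critical_number_le _ _ _ (A *m col_base K)) => v vN.
have : linmap A v \in bose_burton n t.
  by apply: (subsetP SB); rewrite SE imset_f.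
rewrite mem_bose_burton submxE -/K; apply: contraNN.
rewrite mulmxA /linmap => /eqP vK.
by rewrite -(mulmx_base K) mulmxA vK mul0mx.
Qed.

(** The inverse of [row_ebase U] carries the row space of [U] to the span of the first [\rank U]
    unit vectors. *)
Lemma compl_subspace_isomorphic n t (M : {set 'rV['F_2]_n}) (U : 'M['F_2]_n) :
  ~: M = subspace U -> \rank U = (n - t)%N -> isomorphic M (bose_burton n t).
Proof.
move=> MU rU; pose E := row_ebase U; have uE : E \in unitmx := row_ebase_unit U.
have bij : bijective (linmap (invmx E)).
  by exists (linmap E) => v; rewrite /linmap ?mulmxK ?mulmxKV.
have mem v : (v \in M) = (linmap (invmx E) v \in bose_burton n t).
  rewrite mem_bose_burton -rU -(negbK (v \in M)) -in_setC MU inE.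
  congr (~~ _); rewrite -{1}(mulmx_ebase U) -mulmxA.
  rewrite (eqmxMfull _ (_ : row_full (col_ebase U)))
    ?row_full_unit ?col_ebase_unit //.
  by rewrite -{1}[v](mulmxKV uE) submxMfree // row_free_unit.
exists (invmx E) => //; apply/setP => w; apply/imsetP/idP => [[v vM ->]|wB].
  by rewrite -mem.
have [g gK Kg] := bij; exists (g w); last by rewrite Kg.
by rewrite mem Kg.
Qed.

(** * Extremal matroids in large dimension *)

Lemma card_union_overlap n (M : {set 'rV['F_2]_n}) e :
  (#|~: [set x in M | (x + e)%R \in M]| + overlap (~: M) e = 2 * #|~: M|)%N.
Proof.
(* Inclusion-exclusion for the complement of [M] and its translate by [e]. *)
pose C' := [set x + e | x in ~: M].
have memC' x : (x \in C') = (x + e \notin M).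
  apply/imsetP/idP => [[y yM ->]|xM]; first by rewrite addrK_F2 -in_setC.
  by exists (x + e); rewrite ?addrK_F2 // inE.
have cC' : #|C'| = #|~: M|.
  by rewrite card_imset //; apply: can_inj (addrK_F2 e).
rewrite mul2n -addnn -{2}cC' -[RHS]cardsUI; congr (_ + _)%N;
  apply: eq_card => x.
  by rewrite in_setU memC' !inE negb_and.
by rewrite in_setI memC' !inE.
Qed.

Lemma free_large_compl_subspace m t (N : {set 'rV['F_2]_m})
    (P : 'M['F_2]_(m, t)) (e : 'rV['F_2]_m) :
  e != 0 -> e *m P = 0 -> (forall v, v \in N :\ e -> v *m P != 0) ->
  exists n0 : nat, forall n, (n0 <= n)%N -> forall M : {set 'rV['F_2]_n},
    is_matroid M -> is_free N M -> (2 ^ n - 2 ^ (n - t) <= #|M|)%N ->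
    exists2 U : 'M['F_2]_n, ~: M = subspace U & \rank U = (n - t)%N.
Proof.
(* With [2 ^ (t + 9) = 512 * 2 ^ t], the bound [small] below yields the constant 256 of
   [set_stability] once [#|~: M| <= 2 ^ (n - t)]. *)
move=> e0 eP NP; have [n0 big] := free_union_large (t + 9) e0 eP NP.
exists (maxn n0 t) => n; rewrite geq_max => /andP[len tn] M M0 fM Mge.
have cM := cardsC M; rewrite card_F2rV in cM.
have QV : (2 ^ n = 2 ^ t * 2 ^ (n - t))%N by rewrite -expnD subnKC.
have K0 : (0 < 2 ^ t)%N by rewrite expn_gt0.
have PE : (2 ^ (t + 9) = 512 * 2 ^ t)%N by rewrite expnD mulnC.
have Qle : (2 ^ (n - t) <= 2 ^ n)%N by rewrite leq_exp2l // leq_subr.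
have Cle : (#|~: M| <= 2 ^ (n - t))%N.
  by move: cM Mge Qle; move: #|M| #|~: M| (2 ^ n)%N (2 ^ (n - t))%N; lia.
have small e' : e' \in M ->
    (512 * 2 ^ t * (2 * 2 ^ (n - t) + overlap (~: M) e')
       < 512 * 2 ^ t * (2 * #|~: M|) + 2 * 2 ^ (n - t))%N.
  move=> e'M; have := big n len M M0 fM e' e'M.
  rewrite -(card_union_overlap M e') PE QV.
  move: K0 #|_| (overlap _ _) => K0 u o.
  rewrite -(ltn_pmul2l K0); move: (2 ^ t)%N (2 ^ (n - t))%N => K Q.
  by nia.
apply: set_stability => //.
- by rewrite inE.
(* An empty [M] offers no [e'], but then the complement is the whole space. *)
- case: (set_0Vmem M) => [M_0|[e' e'M]].
    by move: cM Qle; rewrite M_0 cards0 add0n => ->; lia.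
  have := small e' e'M; move: K0 Cle; move: #|~: M| (overlap _ _).
  by move: (2 ^ t)%N (2 ^ (n - t))%N; nia.
- move=> e'; rewrite inE negbK => /small.
  move: K0 Cle; move: #|~: M| (overlap _ _).
  by move: (2 ^ t)%N (2 ^ (n - t))%N; nia.
Qed.

Lemma bose_burton_density_rat n t : (t <= n)%N ->
  2%:R ^+ n * (1 - 2%:R ^ (1 - t.+1%:Z)) = (2 ^ n - 2 ^ (n - t))%:R :> rat.
Proof.
move=> tn; have -> : 1 - t.+1%:Z = - t%:Z by lia.
rewrite natrB ?leq_exp2l ?leq_subr // !natrX mulrBr mulr1 exprB ?unitfE //.
by rewrite exprnN.
Qed.

Theorem theorem1p4 (m : nat) (N : {set 'rV['F_2]_m}) (hN : is_matroid N)
    (he : exists2 e : 'rV['F_2]_m,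
            e \in N & (critical_number (N :\ e) < critical_number N)%N) :
  exists n0 : nat, forall n : nat, (n0 <= n)%N ->
    (ex_number N n)%:R
      = 2%:R ^+ n * (1 - 2%:R ^ (1 - (critical_number N)%:Z)) :> rat
    /\ (forall M : {set 'rV['F_2]_n},
          is_matroid M -> is_free N M ->
          #|M|%:R
            = 2%:R ^+ n * (1 - 2%:R ^ (1 - (critical_number N)%:Z)) :> rat ->
          isomorphic M (bose_burton n (critical_number N - 1))).
Proof.
case: he => e eN; case kE: (critical_number N) => [//|t]; rewrite ltnS => le_t.
have e0 : e != 0 by apply: contraNneq hN => <-.
have N'0 : is_matroid (N :\ e) by apply: contraNN hN => /setD1P[].
have [P NP] := critical_number_map N'0 le_t.
(* Otherwise [P] is nonzero on all of [N] and bounds its critical number by [t]. *)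
have eP : e *m P = 0.
  apply/eqP; apply: contraLR (ltnSn t) => eP; rewrite -leqNgt -kE.
  apply: (@critical_number_le _ _ _ P) => v vN; have [->//|ve] := eqVneq v e.
  by apply: NP; rewrite !inE ve.
have [n0 struct] := free_large_compl_subspace e0 eP NP.
exists (maxn n0 t) => n; rewrite geq_max => /andP[len tn].
rewrite bose_burton_density_rat // subn1; split=> [|M M0 fM /eqP].
  congr (_%:R); apply/eqP; rewrite eqn_leq; apply/andP; split.
    (* A larger [M] would also have a complement of exactly [2 ^ (n - t)] elements, which is too
       many. *)
    apply/bigmax_leqP => M /andP[M0 fM]; rewrite leqNgt; apply/negP => Mgt.
    have [U MU rU] := struct n len M M0 fM (ltnW Mgt).
    have := cardsC M; rewrite MU card_subspace rU card_F2rV.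
    by move: #|M| (2 ^ n)%N (2 ^ (n - t))%N Mgt; lia.
  rewrite -card_bose_burton //.
  apply: (@leq_bigmax_cond _ _ (fun M : {set 'rV_n} => #|M|)).
  by rewrite bose_burton_free ?kE // andbT /is_matroid mem_bose_burton sub0mx.
rewrite eqr_nat => /eqP Meq.
have [|U MU rU] := struct n len M M0 fM; first by rewrite Meq.
exact: compl_subspace_isomorphic MU rU.
Qed.
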